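(* Consider an inhomogeneous Galton-Watson tree with offspring distributions $(f_n)_{n\ge 0}$ on the non-negative integers. Let $g_n(s)=\sum_{i=0}^\infty s^if_n(i)$, $s\in[0,1]$, be the probability generating function of $f_n$, and let $Z_n$ be the number of vertices in generation $n$. The probability generating function of $Z_n$ for $n=1,2,\ldots$ is $$G_n(s)=g_0\circ g_1\circ\cdots\circ g_{n-1}(s),$$ where $\circ$ denotes composition. Let $N_{\max}$ be the highest generation number of a vertex in the tree (i.e. the tree height not counting generation $0$). Then the cumulative distribution function of $N_{\max}$ is given by $$P(N_{\max}\le n)=P(Z_{n+1}=0)=G_{n+1}(0),$$ and its mean and variance are given by $$\mathbb{E}(N_{\max})=\sum_{n=0}^\infty\bigl(1-G_{n+1}(0)\bigr),$$ $$\operatorname{Var}(N_{\max})=\left(\sum_{n=0}^\infty(2n+1)\bigl(1-G_{n+1}(0)\bigr)\right)-\left(\sum_{n=0}^\infty\bigl(1-G_{n+1}(0)\bigr)\right)^2.$$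
   Context: Inhomogeneous Galton-Watson tree: generation $0$ consists of one vertex. For $n=0,1,\ldots$, each vertex $i$ in generation $n$ has $X_{n,i}$ offspring (vertices of generation $n+1$), where $X_{n,i}$ is drawn from the distribution with probability function $f_n$ on $\{0,1,2,\ldots\}$, independently of everything else. Each $f_n$ is assumed to have a mean $\mu_n$ and a variance $\sigma_n^2$. The construction ends when there are no new offspring in a generation, and the output is the obtained directed tree. In general the total number of vertices may be infinite with positive probability. *)

(* Defs.v *)
From HB Require Import structures.
From mathcomp Require Export all_boot all_order all_algebra finmap.
(* all_analysis does not export measurable_realfun, which declares the
   measurableType structure of \bar R. *)
From mathcomp Require Export all_classical all_reals all_analysis.
From mathcomp Require Export measurable_realfun.

Set Implicit Arguments.
Unset Strict Implicit.
Unset Printing Implicit Defensive.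

Import Order.TTheory GRing.Theory Num.Theory.
Import numFieldNormedType.Exports.

Local Open Scope classical_set_scope.
Local Open Scope ring_scope.

Section Tree.
Variable x : nat -> nat -> nat. (* x n i: number of offspring of vertex (n, i) *)

(* The vertices of generation n are labelled (n, 0), (n, 1), ...; the children
   of (n, 0) come first in generation n.+1, then those of (n, 1), etc., so that
   (n, i) has exactly x n i children. *)
Definition gw_edge (u v : nat * nat) : Prop :=
  v.1 = u.1.+1 /\
  (\sum_(k < u.2) x u.1 k <= v.2 < \sum_(k < u.2.+1) x u.1 k)%N.

(* Only the entries x n i at labels (n, i) that are vertices play a role. *)
Inductive gw_vertex : nat * nat -> Prop :=
| gw_root : gw_vertex (0%N, 0%N)
| gw_child u v : gw_vertex u -> gw_edge u v -> gw_vertex v.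

(* Each generation is finite, as required for fset_set to be meaningful. *)
Definition gw_size (n : nat) : nat :=
  #|` fset_set [set i : nat | gw_vertex (n, i)] |.

(* Equal to +oo when the tree is infinite. *)
Definition gw_height (R : realType) : \bar R :=
  ereal_sup [set (v.1%:R : R)%:E | v in [set v | gw_vertex v]].

End Tree.

Section Pgf.
Context {R : realType}.

Definition pgf (p : nat -> R) (s : R) : R :=
  limn (series (fun k => s ^+ k * p k)).

Definition is_pmf (p : nat -> R) : Prop :=
  (forall k, 0 <= p k) /\ (\sum_(k <oo) (p k)%:E = 1)%E.

Definition has_mean (p : nat -> R) (m : R) : Prop :=
  (\sum_(k <oo) (k%:R * p k)%:E = m%:E)%E.

Definition has_variance (p : nat -> R) (m v : R) : Prop :=
  (\sum_(k <oo) ((k%:R - m) ^+ 2 * p k)%:E = v%:E)%E.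

(* g 0 \o g 1 \o ... \o g n.-1 *)
Definition iter_comp (g : nat -> R -> R) (n : nat) : R -> R :=
  \big[(fun u v : R -> R => u \o v)/id]_(0 <= i < n) g i.

End Pgf.

Section Probability.
Context {d : measure_display} {T : measurableType d} {R : realType}.
Variable P : probability T R.

Definition mutually_independent (I : choiceType) (X : I -> {RV P >-> nat}) :
    Prop :=
  forall (J : {fset I}) (B : I -> set nat),
    fine (P (\bigcap_(i in [set` J]) (X i @^-1` B i))) =
    \prod_(i <- J) fine (P (X i @^-1` B i)).

Definition nat_pmf (Y : T -> nat) (k : nat) : R := fine (P (Y @^-1` [set k])).

(* Counterparts of 'E_P and 'V_P for extended real-valued variables; the
   variance is meant for variables of finite mean. *)
Definition eexpectation (Y : T -> \bar R) : \bar R := (\int[P]_w Y w)%E.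

Definition evariance (Y : T -> \bar R) : \bar R :=
  eexpectation (fun w => (Y w - eexpectation Y) ^+ 2)%E.

Variable X : nat -> nat -> {RV P >-> nat}.

Definition gw_Z (n : nat) (w : T) : nat := gw_size (fun m i => X m i w) n.

Definition gw_Nmax (w : T) : \bar R := gw_height (fun m i => X m i w) R.

(* X n i has probability function f n, for all n and i, and all the X n i are
   independent. *)
Definition gw_offspring (f : nat -> nat -> R) : Prop :=
  (forall n i k, P (X n i @^-1` [set k]) = (f n k)%:E) /\
  mutually_independent (fun u : nat * nat => X u.1 u.2).

End Probability.

(* G n = g_0 \o ... \o g_(n-1), where g_i is the generating function of f i. *)
Definition gw_G {R : realType} (f : nat -> nat -> R) (n : nat) : R -> R :=
  iter_comp (fun i => pgf (f i)) n.

(* Main.v *)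
Require Import Defs.
From mathcomp Require Import zify ring.

Import Order.TTheory GRing.Theory Num.Theory.
Import numFieldNormedType.Exports.

Local Open Scope classical_set_scope.
Local Open Scope ring_scope.

Set Implicit Arguments.
Unset Strict Implicit.
Unset Printing Implicit Defensive.

(** The event [Z_n = j] only involves offspring numbers of generations before
    [n], so it is independent of the [X_(n,i)]; hence
    [E (s ^ Z_(n+1)) = sum_j P (Z_n = j) g_n(s)^j = E (g_n(s) ^ Z_n)], and the
    generating functions compose. Since a generation is nonempty only if the
    previous ones are, [N_max] is the number of [n >= 0] with [Z_(n+1) > 0], and
    [N_max^2] is the sum of [2 n + 1] over the same [n], so its first two moments
    follow by integrating these series termwise. *)

(** * Generation sizes by recursion *)

Section GenerationSizes.
Local Open Scope nat_scope.

Lemma leq_sum_ord (a : nat -> nat) m n :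
  m <= n -> \sum_(k < m) a k <= \sum_(k < n) a k.
Proof. by move=> /subnKC <-; rewrite big_split_ord/= leq_addr. Qed.

(** The intervals between successive partial sums tile an initial segment of the naturals. With
    [a := x n] the index found is the parent of the vertex labelled [j]. *)
Lemma sum_ord_locate (a : nat -> nat) m j : j < \sum_(k < m) a k ->
  exists2 i, i < m & \sum_(k < i) a k <= j < \sum_(k < i.+1) a k.
Proof.
elim: m => [|m IHm]; first by rewrite big_ord0.
have [lt_j _|le_j lt_j] := ltnP j (\sum_(k < m) a k); last first.
  by exists m => //; rewrite le_j.
by have [i lt_im ij] := IHm lt_j; exists i => //; apply: ltnW.
Qed.

Variable x : nat -> nat -> nat.

(** A recursion to compute with, in place of the cardinal in [gw_size]; [gw_sizeE] identifies the
    two. *)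
Fixpoint gw_count (n : nat) : nat :=
  if n is m.+1 then \sum_(k < gw_count m) x m k else 1.

(** The blocks of children of consecutive parents are adjacent, so if the labels of one generation
    fill an initial segment, those of the next one do too. *)
Lemma gw_vertexP v : gw_vertex x v <-> v.2 < gw_count v.1.
Proof.
split=> [|].
  elim=> {v} [//|u v _ lt_u [-> /andP[_ lt_v]]] /=.
  by apply: leq_trans lt_v _; apply: (leq_sum_ord (x u.1)).
case: v => n; elim: n => [|n IHn] i /=.
  by rewrite ltnS leqn0 => /eqP ->; exact: gw_root.
move=> /(@sum_ord_locate (x n))[k lt_k le_k].
by apply: (@gw_child _ (n, k)) => //; exact: IHn.
Qed.

Lemma gw_sizeE n : gw_size x n = gw_count n.
Proof.
rewrite /gw_size (_ : [set i | _] = `I_(gw_count n)).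
  by rewrite (card_fset_set (card_eqxx _)).
by apply/seteqP; split=> i /= => [/gw_vertexP//|lt_i]; exact/gw_vertexP.
Qed.

Lemma gw_count_gt0W m n : m <= n -> 0 < gw_count n -> 0 < gw_count m.
Proof.
move=> /subnKC <-; elim: (n - m) => [|k IHk]; first by rewrite addn0.
rewrite addnS /= => gt0; apply: IHk; rewrite lt0n; apply: contraTneq gt0 => ->.
by rewrite big_ord0.
Qed.

End GenerationSizes.

(** * The height and its square as series of indicators *)

Section Height.
Variables (R : realType) (x : nat -> nat -> nat).

(** An empty generation has only empty successors, so the nonempty generations form an initial
    segment: either it ends at some [N], or it is everything. *)
Lemma gw_height_cases :
  (exists N, gw_height x R = (N%:R)%:E /\
    forall n, (0 < gw_count x n)%N = (n <= N)%N) \/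
  (gw_height x R = +oo%E /\ forall n, (0 < gw_count x n)%N).
Proof.
have height_ge n : (0 < gw_count x n)%N -> ((n%:R)%:E <= gw_height x R)%E.
  move=> gt0; apply: ereal_sup_ubound; exists (n, 0%N) => //=.
  exact/gw_vertexP.
have [extinct|survive] := pselect (exists n, gw_count x n == 0%N); last first.
  right.
  have gt0 n : (0 < gw_count x n)%N.
    by rewrite lt0n; apply/negP => ?; apply: survive; exists n.
  split=> //; apply/eqyP => A A0.
  apply: le_trans (height_ge (Num.bound A) (gt0 _)).
  by rewrite lee_fin ltW// archi_boundP// ltW.
(* The first empty generation is not generation 0, which contains the root; hence it is some [N.+1],
   and [N] is the height. *)
left; case: (ex_minnP extinct) => -[//|N] /eqP N0 minN.
have gt0E n : (0 < gw_count x n)%N = (n <= N)%N.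
  apply/idP/idP => [gt0|le_nN].
    by rewrite leqNgt; apply/negP => /gw_count_gt0W/(_ gt0); rewrite N0.
  by rewrite lt0n; apply/negP => /minN; rewrite ltnNge le_nN.
exists N; split=> //; apply/eqP; rewrite eq_le height_ge ?gt0E// andbT.
apply: ge_ereal_sup => _ [v /gw_vertexP lt_v <-].
by rewrite lee_fin ler_nat -gt0E (leq_ltn_trans _ lt_v).
Qed.

Lemma gw_height_le n :
  (gw_height x R <= (n%:R)%:E)%E = (gw_count x n.+1 == 0%N).
Proof.
have [[N [-> gt0E]]|[-> gt0]] := gw_height_cases.
  by rewrite lee_fin ler_nat leqNgt eqn0Ngt gt0E.
by rewrite leye_eq; case: (gw_count x n.+1) (gt0 n.+1).
Qed.

(** Evaluates the weighted indicator series of a tree of finite height [N]: [b n] will say that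
    generation [n.+1] is nonempty, and [w n] will be [1] or [2 * n + 1]. *)
Lemma nneseries_prefix (w : nat -> R) (b : nat -> bool) N :
  (forall n, 0 <= w n) -> (forall n, b n = (n < N)%N) ->
  (\sum_(n <oo) (w n * (b n)%:R)%:E = (\sum_(n < N) w n)%:E)%E.
Proof.
move=> w0 bE; rewrite (nneseries_split 0 N) => [|k _]; last first.
  by rewrite lee_fin mulr_ge0.
rewrite add0n eseries0 ?adde0 => [|k le_k _]; last first.
  by rewrite bE ltnNge le_k mulr0.
rewrite big_mkord -sumEFin; apply: eq_bigr => i _.
by rewrite bE ltn_ord mulr1.
Qed.

(** The counterpart for infinite trees, where every indicator equals 1. *)
Lemma nneseries_ge1 (w : nat -> R) :
  (forall n, 1 <= w n) -> (\sum_(n <oo) (w n)%:E = +oo)%E.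
Proof.
move=> w1; apply/eqyP => A A0.
apply: le_trans (nneseries_lim_ge (Num.bound A) _); last first.
  by move=> n _ _; rewrite lee_fin (le_trans ler01).
rewrite sumEFin lee_fin; apply: (@le_trans _ _ (Num.bound A)%:R).
  by rewrite ltW// archi_boundP// ltW.
by rewrite -[X in X%:R]subn0 -sumr_const_nat; exact: ler_sum.
Qed.

Lemma gw_heightE :
  (gw_height x R = \sum_(n <oo) ((0 < gw_count x n.+1)%N%:R)%:E)%E.
Proof.
transitivity (\sum_(n <oo) (1 * (0 < gw_count x n.+1)%N%:R : R)%:E)%E; last first.
  by apply: eq_eseriesr => n _; rewrite mul1r.
have [[N [-> gt0E]]|[-> gt0]] := gw_height_cases.
  by rewrite (@nneseries_prefix _ _ N)// sumr_const card_ord.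
by rewrite nneseries_ge1// => n; rewrite gt0 mulr1.
Qed.

(* [2 n + 1 = (n + 1)^2 - n^2] telescopes to the square of the height. *)
Lemma gw_height_sqrE : (gw_height x R ^+ 2 =
  \sum_(n <oo) ((2 * n + 1)%:R * (0 < gw_count x n.+1)%N%:R)%:E)%E.
Proof.
have [[N [-> gt0E]]|[-> gt0]] := gw_height_cases.
  rewrite (@nneseries_prefix _ _ N)//.
  rewrite -EFin_expe -natrX -natr_sum; congr (_%:R%:E).
  elim: N {gt0E} => [|N IHN]; first by rewrite big_ord0.
  by rewrite big_ord_recr/= -IHN -addn1 sqrnD muln1 exp1n addnAC addnA addnAC.
by rewrite nneseries_ge1// => n; rewrite gt0 mulr1 ler1n addn1.
Qed.

End Height.

(** * Countable partitions by the values of a [nat]-valued variable *)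

Section NatValued.
Context {d : measure_display} {T : measurableType d} {R : realType}.
Variable P : probability T R.

Lemma measurable_nat_preimage (Y : T -> nat) (B : set nat) :
  measurable_fun [set: T] Y -> measurable (Y @^-1` B).
Proof. by move=> mY; rewrite -[_ @^-1` _]setTI; exact: mY. Qed.

Lemma measurable_nat_comp (g : nat -> \bar R) (Y : T -> nat) :
  measurable_fun [set: T] Y -> measurable_fun [set: T] (g \o Y).
Proof. by move=> mY; apply: measurableT_comp. Qed.

Lemma bigcup_fibers (Y : T -> nat) (A : set T) :
  \bigcup_l (A `&` Y @^-1` [set l]) = A.
Proof.
by apply/seteqP; split=> [w [l _ []]|w Aw] //; exists (Y w).
Qed.

Lemma trivIset_fibers (Y : T -> nat) (A : set T) :
  trivIset [set: nat] (fun l => A `&` Y @^-1` [set l]).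
Proof. by move=> i j _ _ [w [[_ <-] [_ <-]]]. Qed.

(** Meant for events about sums with a random number [Y] of terms, which are explicit only once the
    value of [Y] is fixed. *)
Lemma measurable_fibers (Y : T -> nat) (A : set T) :
  (forall l, measurable (A `&` Y @^-1` [set l])) -> measurable A.
Proof. by move=> mA; rewrite -(bigcup_fibers Y A); exact: bigcupT_measurable. Qed.

Lemma measure_fibers (Y : T -> nat) (A : set T) :
  (forall l, measurable (A `&` Y @^-1` [set l])) ->
  (P A = \sum_(l <oo) P (A `&` Y @^-1` [set l]))%E.
Proof.
move=> mA; rewrite -{1}(bigcup_fibers Y A) measure_semi_bigcup//.
  exact: trivIset_fibers.
exact: bigcupT_measurable.
Qed.

Lemma ge0_integral_fibers (Y : T -> nat) (A : set T) (h : T -> \bar R) :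
  measurable A -> measurable_fun [set: T] Y ->
  measurable_fun [set: T] h -> (forall w, 0 <= h w)%E ->
  (\int[P]_(w in A) h w =
   \sum_(l <oo) \int[P]_(w in A `&` Y @^-1` [set l]) h w)%E.
Proof.
move=> mA mY mh h0; rewrite -{1}(bigcup_fibers Y A) ge0_integral_bigcup//.
- by move=> l; apply: measurableI => //; exact: measurable_nat_preimage.
- rewrite bigcup_fibers; exact: measurable_funTS.
- exact: trivIset_fibers.
Qed.

Lemma integral_nat_comp (Y : T -> nat) (A : set T) (g : nat -> \bar R) :
  measurable A -> measurable_fun [set: T] Y -> (forall k, 0 <= g k)%E ->
  (\int[P]_(w in A) g (Y w) = \sum_(l <oo) g l * P (A `&` Y @^-1` [set l]))%E.
Proof.
move=> mA mY g0; rewrite (@ge0_integral_fibers Y)//; last first.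
  exact: measurable_nat_comp.
apply: eq_eseriesr => l _; rewrite -integral_cst; last first.
  by apply: measurableI => //; exact: measurable_nat_preimage.
by apply: eq_integral => w; rewrite inE => -[_ /= ->].
Qed.

End NatValued.

(** * Generating functions on the unit interval and their composition *)

Section Pgf.
Context {R : realType}.

(** [pgf] is a limit in [R], meaningful only if the series converges. Termwise comparison with the
    total mass bounds its nondecreasing partial sums by 1. The bounds on the value allow generating
    functions to be composed. *)
Lemma pgf_EFin (p : nat -> R) (s : R) : is_pmf p -> 0 <= s <= 1 ->
  ((pgf p s)%:E = \sum_(k <oo) (s ^+ k * p k)%:E)%E /\ 0 <= pgf p s <= 1.
Proof.
move=> [p0 p1] /andP[s0 s1].
have t0 k : 0 <= s ^+ k * p k by rewrite mulr_ge0// exprn_ge0.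
have le1 : (\sum_(k <oo) (s ^+ k * p k)%:E <= 1)%E.
  rewrite -p1; apply: lee_nneseries => k _ //; rewrite lee_fin ?t0//.
  by rewrite ler_piMl// exprn_ile1.
have ge0 : (0 <= \sum_(k <oo) (s ^+ k * p k)%:E)%E.
  by apply: nneseries_ge0 => k _ _; rewrite lee_fin.
have cvg_p : cvgn (series (fun k => s ^+ k * p k)).
  apply: nondecreasing_is_cvgn; first exact: nondecreasing_series.
  exists 1 => _ [n _ <-]; rewrite -lee_fin; apply: le_trans le1.
  rewrite /series/= -sumEFin; apply: nneseries_lim_ge => k _ _.
  by rewrite lee_fin.
have pE : ((pgf p s)%:E = \sum_(k <oo) (s ^+ k * p k)%:E)%E.
  rewrite /pgf -EFin_lim//; congr (limn _); apply/funext => n /=.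
  by rewrite /series/= -sumEFin.
by split=> //; rewrite -2!lee_fin pE ge0 le1.
Qed.

(** The big operator exposes the outermost factor [g 0], whereas induction on generations needs the
    innermost one; unfolding to [foldr] over [iota] gives access to the end of the list. *)
Lemma iter_compSr (g : nat -> R -> R) n s :
  iter_comp g n.+1 s = iter_comp g n (g n s).
Proof.
rewrite /iter_comp unlock /reducebig /index_iota !subn0 -[n.+1]addn1 iotaD /= foldr_cat /=.
by elim: (iota 0 n) => //= i r ->.
Qed.

End Pgf.

(** * Independence of an event from a family of variables *)

Section Independence.
Context {d : measure_display} {T : measurableType d} {R : realType}.
Variables (P : probability T R) (I : choiceType) (X : I -> {RV P >-> nat}).
Implicit Types (A : set T) (U : set I) (B : set nat).

(** Product events over finite subfamilies suffice here, so no generated sigma-algebra appears. The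
    right-hand side is factored down to single variables, so that these can be moved into the event
    one by one. *)
Definition indep_of A U : Prop := forall (J : {fset I}) (B : I -> set nat),
  [set` J] `<=` U ->
  P (A `&` \bigcap_(i in [set` J]) (X i @^-1` B i)) =
    (P A * (\prod_(i <- J) fine (P (X i @^-1` B i)))%:E)%E.

Lemma measurable_RV_preimage i B : measurable (X i @^-1` B).
Proof. by apply: measurable_nat_preimage; exact: measurable_funPT. Qed.

Lemma indep_of_setT U : mutually_independent X -> indep_of [set: T] U.
Proof.
move=> indX J B _; rewrite setTI probability_setT mul1e -indX fineK//.
rewrite fin_num_measure//; apply: fin_bigcap_measurable => // i _.
exact: measurable_RV_preimage.
Qed.

Lemma indep_ofW A U V : V `<=` U -> indep_of A U -> indep_of A V.
Proof. by move=> VU indA J B JV; exact/indA/(subset_trans JV). Qed.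

Lemma indep_of_measureI A U i B : indep_of A U -> U i ->
  P (A `&` X i @^-1` B) = (P A * P (X i @^-1` B))%E.
Proof.
move=> indA Ui; have := indA [fset i]%fset (fun=> B).
rewrite big_seq_fset1 fineK ?fin_num_measure//; last first.
  exact: measurable_RV_preimage.
rewrite set_fset1 bigcap_set1; apply.
by move=> j ->.
Qed.

(** Absorbing a variable into the event costs only its own index: independence of [A] is applied to
    [J] enlarged by [i], with [B] at [i] and [C] elsewhere. *)
Lemma indep_ofI A U i B : indep_of A U -> U i ->
  indep_of (A `&` X i @^-1` B) (U `\ i).
Proof.
move=> indA Ui J C JU; rewrite (indep_of_measureI _ indA Ui).
have iJ : i \notin J by apply/negP => /JU[_]; apply.
pose D j := if j == i then B else C j.
have Di : D i = B by rewrite /D eqxx.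
have DJ j : j \in J -> D j = C j.
  by rewrite /D; case: eqP => // -> iJ'; rewrite iJ' in iJ.
have := indA (i |` J)%fset D; rewrite big_fsetU1//= bigcap_fsetU1 setIA.
rewrite Di (eq_bigcapr (G := fun j => X j @^-1` C j)); last first.
  by move=> j /= /DJ ->.
move=> ->; last by move=> j /= /fset1UP[->//|/JU[]].
rewrite EFinM fineK ?fin_num_measure ?muleA//; last first.
  exact: measurable_RV_preimage.
by congr (_ * _%:E)%E; rewrite big_seq [RHS]big_seq; apply: eq_bigr => j /DJ ->.
Qed.

(** Both sides of the product formula are countably additive in the event, so it may be checked with
    [Y] frozen at each value. *)
Lemma indep_of_fibers (Y : T -> nat) A U :
  (forall l, measurable (A `&` Y @^-1` [set l])) ->
  (forall l, indep_of (A `&` Y @^-1` [set l]) U) -> indep_of A U.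
Proof.
move=> mA indA J B JU; set C := \bigcap_(_ in _) _.
have mC : measurable C.
  by apply: fin_bigcap_measurable => // i _; exact: measurable_RV_preimage.
rewrite (@measure_fibers _ _ _ P Y (A `&` C)) => [|l]; last first.
  by rewrite setIAC; exact: measurableI.
rewrite (@measure_fibers _ _ _ P Y A)// muleC -nneseriesZl => [|//].
by apply: eq_eseriesr => l _; rewrite setIAC muleC indA.
Qed.

End Independence.

(** * Distribution of the generation sizes *)

Section GaltonWatson.
Context {d : measure_display} {T : measurableType d} {R : realType}.
Variables (P : probability T R) (X : nat -> nat -> {RV P >-> nat}).

Let S (n j : nat) (w : T) : nat := (\sum_(k < j) X n k w)%N.
Let Z (n : nat) (w : T) : nat := gw_count (fun m i => X m i w) n.
Let XX (u : nat * nat) := X u.1 u.2.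

Lemma measurable_offspring_sum n j : measurable_fun [set: T] (S n j).
Proof.
elim: j => [|j IHj]; rewrite /S.
  by under eq_fun do rewrite big_ord0; exact: measurable_cst.
under eq_fun do rewrite big_ord_recr/=.
by apply: measurable_fun_addn => //; exact: measurable_funPT.
Qed.

(** Freezing [Z n] at [j] turns the random number of summands of [Z n.+1] into the fixed number
    [j]. *)
Lemma gw_count_fiber n j B :
  Z n.+1 @^-1` B `&` Z n @^-1` [set j] = Z n @^-1` [set j] `&` S n j @^-1` B.
Proof.
by apply/seteqP; split=> w /= [] => [ZB <-|<- SB].
Qed.

Lemma measurable_gw_count n : measurable_fun [set: T] (Z n).
Proof.
elim: n => [|n IHn]; first exact: measurable_cst.
move=> _ B _; rewrite setTI; apply: (measurable_fibers (Y := Z n)) => j.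
rewrite gw_count_fiber; apply: measurableI; apply: measurable_nat_preimage => //.
exact: measurable_offspring_sum.
Qed.

(** The indices left free are the labels from [j] on in generation [n] and all later generations.
    The induction on [j] splits on the value of [X n j], and each step uses up the index
    [(n, j)]. *)
Lemma indep_offspring_sum n j A B : measurable A ->
  indep_of XX A [set u | n <= u.1]%N ->
  indep_of XX (A `&` S n j @^-1` B)
    [set u | n <= u.1 /\ (n < u.1 \/ j <= u.2)]%N.
Proof.
move=> mA indA; elim: j B => [|j IHj] B.
  (* The empty sum is the constant 0, so the event is [A] or empty according to whether [B] contains
     0. *)
  have [B0|B0] := pselect (B 0%N).
    rewrite (_ : _ `&` _ = A); first by apply: indep_ofW indA => u [].
    by apply/seteqP; split=> w /= => [[]//|Aw]; split=> //; rewrite /S big_ord0.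
  rewrite (_ : _ `&` _ = set0) => [J C _|]; first by rewrite set0I measure0 mul0e.
  by apply/seteqP; split=> w //= [_]; rewrite /S big_ord0.
(* Where [X n j] equals [l], the last summand is a constant and is moved into the target set. *)
have fiberE l : A `&` S n j.+1 @^-1` B `&` X n j @^-1` [set l] =
    A `&` S n j @^-1` [set m | B (m + l)%N] `&` X n j @^-1` [set l].
  by apply/seteqP; split=> w /= [[Aw Bw] Xl]; split=> //; split=> //;
    move: Bw; rewrite /S big_ord_recr/= Xl.
apply: (@indep_of_fibers _ _ _ _ _ _ (X n j)) => l; rewrite fiberE.
  apply: measurableI; last exact: measurable_RV_preimage.
  apply: measurableI => //; apply: measurable_nat_preimage.
  exact: measurable_offspring_sum.
have := @indep_ofI _ _ _ _ _ XX _ _ (n, j) [set l] (IHj [set m | B (m + l)%N]).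
move=> /(_ (conj (leqnn n) (or_intror (leqnn j))))/=; apply: indep_ofW.
move=> [m i] /= [le_nm lt_ij]; split; first by split=> //; lia.
by move=> [mn ij]; lia.
Qed.

(** On each fiber of [Z n], an event about [Z n.+1] adds only a condition on offspring of generation
    [n], so all later generations stay free. *)
Lemma indep_gw_count n B : mutually_independent XX ->
  indep_of XX (Z n @^-1` B) [set u | n <= u.1]%N.
Proof.
move=> indX; elim: n B => [|n IHn] B.
  have [B1|B1] := pselect (B 1%N).
    rewrite (_ : _ @^-1` _ = setT); first exact: indep_of_setT.
    by apply/seteqP; split.
  rewrite (_ : _ @^-1` _ = set0) => [J C _|]; last by apply/seteqP; split.
  by rewrite set0I measure0 mul0e.
apply: (@indep_of_fibers _ _ _ _ _ _ (Z n)) => j; rewrite gw_count_fiber.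
  apply: measurableI; apply: measurable_nat_preimage.
    exact: measurable_gw_count.
  exact: measurable_offspring_sum.
have mZ : measurable (Z n @^-1` [set j]).
  by apply: measurable_nat_preimage; exact: measurable_gw_count.
apply: indep_ofW (@indep_offspring_sum n j _ B mZ (IHn _)).
by move=> u /= lt_nu; split; [exact: ltnW|left].
Qed.

Variable f : nat -> nat -> R.
Hypotheses (f_pmf : forall n, is_pmf (f n)) (X_offspring : gw_offspring X f).

(** Each summand contributes one factor [pgf (f n) s]: on a fiber of [S n j] the first [j] terms
    give a constant power of [s], and [X n j] is independent of [A] intersected with that fiber. *)
Lemma integral_offspring_sum n j A s : measurable A -> 0 <= s <= 1 ->
  indep_of XX A [set u | n <= u.1]%N ->
  (\int[P]_(w in A) (s ^+ S n j w)%:E = (pgf (f n) s ^+ j)%:E * P A)%E.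
Proof.
move=> mA s01 indA; have /andP[s0 s1] := s01.
have [gE _] := pgf_EFin (f_pmf n) s01.
elim: j => [|j IHj].
  rewrite expr0 -(integral_cst P mA 1%:E).
  by apply: eq_integral => w _; rewrite /S big_ord0.
have mS k := measurable_offspring_sum n k.
have s_ge0 k : (0 <= (s ^+ k)%:E)%E by rewrite lee_fin exprn_ge0.
have mSj k : measurable (A `&` S n j @^-1` [set k]).
  by apply: measurableI => //; exact: measurable_nat_preimage.
have mXn : measurable_fun [set: T] (X n j) by exact: measurable_funPT.
rewrite (@ge0_integral_fibers _ _ _ _ (S n j))//; last first.
  by apply: (measurable_nat_comp (fun k => (s ^+ k)%:E)).
transitivity (\sum_(k <oo) (pgf (f n) s)%:E *
    ((s ^+ k)%:E * P (A `&` S n j @^-1` [set k])))%E; last first.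
  rewrite nneseriesZl => [|k _]; last exact: mule_ge0.
  by rewrite -(@integral_nat_comp _ _ _ P _ _ (fun k => (s ^+ k)%:E))// IHj exprS EFinM muleA.
apply: eq_eseriesr => k _; rewrite muleCA.
transitivity (\int[P]_(w in A `&` S n j @^-1` [set k])
    ((s ^+ k)%:E * (s ^+ X n j w)%:E))%E.
  apply: eq_integral => w; rewrite inE => -[_ /= Sk].
  by rewrite /S big_ord_recr/= -/(S n j w) Sk exprD EFinM.
rewrite ge0_integralZl_EFin ?exprn_ge0//; last first.
  by apply: measurable_funTS; exact: (measurable_nat_comp (fun k => (s ^+ k)%:E)).
congr (_ * _)%E.
rewrite (@integral_nat_comp _ _ _ P _ _ (fun k => (s ^+ k)%:E))// gE muleC.
  rewrite -[P (_ `&` S n j @^-1` _)]fineK ?fin_num_measure// -nneseriesZl.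
    apply: eq_eseriesr => l _; rewrite fineK ?fin_num_measure//.
  (* [S n j] involves only labels below [j], so [(n, j)] is still a free index. *)
  have indS := @indep_offspring_sum n j _ [set k] mA indA.
  rewrite (@indep_of_measureI _ _ _ _ _ XX _ _ (n, j) _ indS)/=; last first.
    by split=> //; right.
  by rewrite X_offspring.1 EFinM muleCA.
move=> l _; rewrite lee_fin mulr_ge0 ?exprn_ge0//; exact: (f_pmf n).1.
Qed.

(** On the event [Z n = j], the previous lemma applies to [S n j] with that very event as [A]. *)
Lemma integral_gw_countS n s : 0 <= s <= 1 ->
  (\int[P]_w (s ^+ Z n.+1 w)%:E = \int[P]_w (pgf (f n) s ^+ Z n w)%:E)%E.
Proof.
move=> s01; have /andP[s0 s1] := s01.
have [_ /andP[g0 _]] := pgf_EFin (f_pmf n) s01.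
have mZ k := measurable_gw_count k.
rewrite (@ge0_integral_fibers _ _ _ _ (Z n))//; first last.
- by move=> w; rewrite lee_fin exprn_ge0.
- exact: (measurable_nat_comp (fun k => (s ^+ k)%:E)).
rewrite (@integral_nat_comp _ _ _ P _ _ (fun k => (pgf (f n) s ^+ k)%:E))//.
  2: by move=> k; rewrite lee_fin exprn_ge0.
apply: eq_eseriesr => j _; rewrite setTI.
rewrite -integral_offspring_sum//; first last.
- by apply: indep_gw_count; exact: X_offspring.2.
- exact: measurable_nat_preimage.
by apply: eq_integral => w; rewrite inE /= /Z/= => ->.
Qed.

Lemma integral_gw_count n s : 0 <= s <= 1 ->
  (\int[P]_w (s ^+ Z n w)%:E = (gw_G f n s)%:E)%E.
Proof.
(* The point [s] must vary: the induction hypothesis is applied at [pgf (f n) s], which again lies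
   in the unit interval. *)
elim: n s => [|n IHn] s s01.
  rewrite [in RHS]/gw_G /iter_comp big_nil.
  by rewrite -[RHS]mule1 -(probability_setT P) -integral_cst.
rewrite integral_gw_countS// IHn; last by have [_] := pgf_EFin (f_pmf n) s01.
by rewrite /gw_G iter_compSr.
Qed.

Lemma is_pmf_nat_pmf (Y : T -> nat) :
  measurable_fun [set: T] Y -> is_pmf (nat_pmf P Y).
Proof.
move=> mY; have mYk k : measurable (Y @^-1` [set k]).
  exact: measurable_nat_preimage.
split=> [k|]; first by rewrite fine_ge0.
rewrite -(probability_setT P) (@measure_fibers _ _ _ P Y setT) => [|k].
  by apply: eq_eseriesr => k _; rewrite setTI fineK// fin_num_measure.
by rewrite setTI.
Qed.

Lemma pgf_gw_count n s : 0 <= s <= 1 ->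
  pgf (nat_pmf P (Z n)) s = gw_G f n s.
Proof.
move=> s01; have /andP[s0 s1] := s01.
have mZ := measurable_gw_count n.
have [pE _] := pgf_EFin (is_pmf_nat_pmf mZ) s01.
apply: EFin_inj; rewrite pE -integral_gw_count//.
rewrite (@integral_nat_comp _ _ _ P _ _ (fun k => (s ^+ k)%:E))//; last first.
  by move=> k; rewrite lee_fin exprn_ge0.
apply: eq_eseriesr => k _; rewrite setTI EFinM fineK// fin_num_measure//.
exact: measurable_nat_preimage.
Qed.

Lemma probability_gw_count0 n : P [set w | Z n w = 0%N] = (gw_G f n 0)%:E.
Proof.
have mZ0 : measurable [set w | Z n w = 0%N].
  exact: (measurable_nat_preimage [set 0%N] (measurable_gw_count n)).
(* At [s = 0] the integrand is the indicator of [Z n = 0], by the convention that [0 ^+ 0] is 1. *)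
rewrite -integral_gw_count ?lexx ?ler01// -[X in P X]setIT -integral_indic//.
apply: eq_integral => w _; rewrite expr0n indicE; congr ((nat_of_bool _)%:R%:E).
by case: eqP => Z0; [rewrite mem_set | rewrite memNset].
Qed.

Lemma probability_gw_count_gt0 n :
  P [set w | (0 < Z n w)%N] = (1 - gw_G f n 0)%:E.
Proof.
rewrite (_ : [set w | _] = ~` [set w | Z n w = 0%N]); last first.
  by apply/seteqP; split=> w /=; rewrite lt0n => /eqP.
rewrite probability_setC; last first.
  exact: (measurable_nat_preimage [set 0%N] (measurable_gw_count n)).
by rewrite probability_gw_count0 EFinB.
Qed.

(** Termwise integration by nonnegativity. Weights [c n = 1] serve the mean, and [c n = 2 * n + 1]
    the second moment. *)
Lemma integral_nneseries_gw_count (c : nat -> R) : (forall n, 0 <= c n) ->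
  (\int[P]_w \sum_(n <oo) (c n * (0 < Z n.+1 w)%N%:R)%:E =
   \sum_(n <oo) (c n * (1 - gw_G f n.+1 0))%:E)%E.
Proof.
move=> c0.
have mZ n : measurable_fun [set: T] (fun w => (c n * (0 < Z n.+1 w)%N%:R)%:E).
  exact: (measurable_nat_comp (fun k => (c n * (0 < k)%N%:R)%:E)
    (measurable_gw_count n.+1)).
rewrite integral_nneseries// => [|n w _]; last by rewrite lee_fin mulr_ge0.
apply: eq_eseriesr => n _.
have mZ0 : measurable [set w | (0 < Z n.+1 w)%N].
  exact: (measurable_nat_preimage [set k | (0 < k)%N] (measurable_gw_count _)).
rewrite EFinM -probability_gw_count_gt0 -[X in P X]setIT -integral_indic//.
rewrite -ge0_integralZl_EFin//; last exact/measurable_EFinP.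
apply: eq_integral => w _; rewrite EFinM indicE.
congr (_ * (nat_of_bool _)%:R%:E)%E.
by case: ltnP => Z0; [rewrite mem_set | rewrite memNset// /= ltnNge Z0].
Qed.

End GaltonWatson.

(** * Variance of an extended real-valued variable, and the final assembly *)

Section Variance.
Context {d : measure_display} {T : measurableType d} {R : realType}.
Variable P : probability T R.

(** At [y = +oo] both sides are [+oo], even for [m = 0], because the term added on the left is
    nonnegative and so cannot be [-oo]. *)
Lemma sqre_subr_add (y : \bar R) (m : R) : (0 <= y)%E -> 0 <= m ->
  ((y - m%:E) ^+ 2 + (2 * m)%:E * y = y ^+ 2 + (m ^+ 2)%:E)%E.
Proof.
case: y => [y| |]// y0 m0.
  by rewrite -EFinB -!EFin_expe -EFinM -!EFinD; congr (_%:E); ring.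
by rewrite !expe2 !mulyy/= addye// -ltNye (lt_le_trans _ (mule_ge0 _ _))
  ?ltNy0// lee_fin mulr_ge0.
Qed.

(* Integrating [(Y - m)^2 + 2 m Y = Y^2 + m^2] avoids subtracting infinities:
   the second moment of [Y] may be infinite. *)
Lemma evarianceE (Y : T -> \bar R) : measurable_fun [set: T] Y ->
  (forall w, 0 <= Y w)%E -> (eexpectation P Y < +oo)%E ->
  (evariance P Y =
   eexpectation P (fun w => Y w ^+ 2) - (eexpectation P Y) ^+ 2)%E.
Proof.
move=> mY Y0 EYoo.
have mYB2 m : measurable_fun [set: T] (fun w => (Y w - m) ^+ 2)%E.
  by apply: emeasurable_funM; apply: emeasurable_funB.
have mY2 : measurable_fun [set: T] (fun w => Y w ^+ 2)%E.
  exact: emeasurable_funM.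
have EY0 : (0 <= eexpectation P Y)%E by apply: integral_ge0.
have EYfin : eexpectation P Y \is a fin_num by rewrite ge0_fin_numE.
pose m := fine (eexpectation P Y).
have mE : eexpectation P Y = m%:E by rewrite fineK.
have m0 : 0 <= m by rewrite fine_ge0.
have m2Y0 w : (0 <= (2 * m)%:E * Y w)%E.
  by rewrite mule_ge0// lee_fin mulr_ge0.
have sqr_ge0 (y : \bar R) : (0 <= y ^+ 2)%E by exact: sqre_ge0.
have : (evariance P Y + (2 * m)%:E * m%:E =
    eexpectation P (fun w => Y w ^+ 2) + (m ^+ 2)%:E)%E.
  have -> : ((2 * m)%:E * m%:E = \int[P]_w ((2 * m)%:E * Y w))%E.
    by rewrite ge0_integralZl_EFin ?mulr_ge0// -mE.
  rewrite /evariance mE /eexpectation.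
  have -> : ((m ^+ 2)%:E = \int[P]_w cst (m ^+ 2)%:E w)%E.
    by rewrite integral_cst// -[LHS]mule1 -(probability_setT P).
  rewrite -!ge0_integralD//; first last.
  - exact: measurable_funeM.
  - by move=> w _; rewrite lee_fin exprn_ge0.
  by apply: eq_integral => w _; rewrite sqre_subr_add.
rewrite -EFinM => VE.
(* Only the finite number [2 * m * m] is cancelled; the remainder is
   [m ^+ 2 - 2 * m * m = - m ^+ 2]. *)
rewrite -[LHS](@addeK _ (2 * m * m)%:E)// VE mE -EFin_expe -addeA.
by rewrite -EFinB -EFinN; congr (_ + _%:E)%E; ring.
Qed.

End Variance.

Theorem mainTheorem3 (d : measure_display) (T : measurableType d)
    (R : realType) (P : probability T R)
    (f : nat -> nat -> R) (mu sigma2 : nat -> R)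
    (f_pmf : forall n, is_pmf (f n))
    (f_mean : forall n, has_mean (f n) (mu n))
    (f_var : forall n, has_variance (f n) (mu n) (sigma2 n))
    (X : nat -> nat -> {RV P >-> nat})
    (X_offspring : gw_offspring X f) :
  (forall n, measurable_fun [set: T] (gw_Z X n)) /\
  (forall (n : nat) (s : R), (0 < n)%N -> 0 <= s <= 1 ->
     pgf (nat_pmf P (gw_Z X n)) s = gw_G f n s) /\
  measurable_fun [set: T] (gw_Nmax X) /\
  (forall n : nat,
     P [set w | (gw_Nmax X w <= (n%:R)%:E)%E] =
       P [set w | gw_Z X n.+1 w = 0%N] /\
     P [set w | gw_Z X n.+1 w = 0%N] = (gw_G f n.+1 0)%:E) /\
  eexpectation P (gw_Nmax X) = (\sum_(n <oo) (1 - gw_G f n.+1 0)%:E)%E /\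
  ((eexpectation P (gw_Nmax X) < +oo)%E ->
   evariance P (gw_Nmax X) =
     (\sum_(n <oo) ((2 * n + 1)%:R * (1 - gw_G f n.+1 0))%:E
      - (\sum_(n <oo) (1 - gw_G f n.+1 0)%:E) ^+ 2)%E).
Proof.
have ZE n : gw_Z X n = (fun w => gw_count (fun m i => X m i w) n).
  by apply/funext => w; rewrite /gw_Z gw_sizeE.
have mZ n : measurable_fun [set: T] (gw_Z X n).
  by rewrite ZE; exact: measurable_gw_count.
pose b n (w : T) : R := (0 < gw_count (fun m i => X m i w) n.+1)%N%:R.
have mNmax : measurable_fun [set: T] (gw_Nmax X).
  (* The height is a supremum over a random set; its measurability is read off the series of
     indicators instead. *)
  rewrite (_ : gw_Nmax X = fun w => \sum_(n <oo) (b n w)%:E)%E; last first.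
    by apply/funext => w; rewrite /gw_Nmax gw_heightE.
  apply: ge0_emeasurable_sum => [n w _ _|n _]; first by rewrite lee_fin.
  exact: (measurable_nat_comp (fun k => ((0 < k)%N%:R)%:E)
    (measurable_gw_count X n.+1)).
have Nmax0 w : (0 <= gw_Nmax X w)%E.
  by rewrite /gw_Nmax gw_heightE; apply: nneseries_ge0 => n _ _; rewrite lee_fin.
have EN : eexpectation P (gw_Nmax X) =
    (\sum_(n <oo) (1 - gw_G f n.+1 0)%:E)%E.
  transitivity (\sum_(n <oo) (1 * (1 - gw_G f n.+1 0))%:E)%E; last first.
    by apply: eq_eseriesr => n _; rewrite mul1r.
  rewrite -(integral_nneseries_gw_count f_pmf X_offspring)//.
  apply: eq_integral => w _; rewrite /gw_Nmax gw_heightE.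
  by apply: eq_eseriesr => n _; rewrite mul1r.
split=> //; split=> [n s _ s01|].
  by rewrite ZE; exact: pgf_gw_count.
split=> //; split=> [n|].
  split; last by rewrite ZE; exact: probability_gw_count0.
  congr (P _); apply/funext => w; rewrite /= /gw_Nmax gw_height_le ZE.
  by apply/propext; split=> /eqP.
(* The finite mean is what [evarianceE] requires; only the second moment is then left to compute. *)
split=> // EN_lty; rewrite evarianceE// EN; congr (_ - _)%E.
rewrite -(integral_nneseries_gw_count f_pmf X_offspring)//.
by apply: eq_integral => w _; rewrite /gw_Nmax gw_height_sqrE.
Qed.
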